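(* Let $n\ge 1$, $0<d<n$, let $\delta\in(0,1)$ be the solution of $2^{n-d}(1-\delta)^d=1$, and let $Q_0=E^0=[0,1)^n$. Let $E^k$ ($k\ge 0$) be the sets and $\mathcal{S}_0=\{Q_j^k\}$ the family of all cubes obtained in the Cantor construction described in the context. Then there are constants $0<c\le C<\infty$, independent of $k$, such that $$c\le H^d(E^k)\le C\qquad\text{for all }k=0,1,2,\ldots$$ Moreover, for every $0<p<\infty$ the sparse operator $\mathcal{A}_{\mathcal{S}_0}$ is not bounded on the Choquet space $\mathcal{L}^p(H^d)$; that is, there is no finite constant $K$ such that $\|\mathcal{A}_{\mathcal{S}_0}f\|_{\mathcal{L}^p(H^d)}\le K\|f\|_{\mathcal{L}^p(H^d)}$ for all locally integrable $f\in\mathcal{L}^p(H^d)$.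
   Context: Dyadic cubes: $\mathcal{D}$ is the class of cubes $Q=2^{-k}(j+[0,1)^n)$, $k\in\mathbb{Z}$, $j\in\mathbb{Z}^n$; $\ell(Q)$ denotes side length. The dyadic Hausdorff content of $E\subset\mathbb{R}^n$ is $H^d(E)=\inf\{\sum_j\ell(Q_j)^d: E\subset\bigcup_jQ_j,\ Q_j\in\mathcal{D}\}$, the infimum over countable coverings. The Choquet integral of $f\ge0$ is $\int_{\mathbb{R}^n}f\,dH^d=\int_0^\infty H^d(\{f>t\})\,dt$. For $0<p<\infty$, $\|f\|_{\mathcal{L}^p(H^d)}=(\int_{\mathbb{R}^n}|f|^p\,dH^d)^{1/p}$, and the Choquet space $\mathcal{L}^p(H^d)$ is the completion, with respect to this functional, of the space $C_0(\mathbb{R}^n)$ of continuous functions with compact support. Cantor construction: start from the single cube $Q_0=E^0=[0,1)^n$. Delete from $Q_0$ all but the $2^n$ (half-open) corner cubes $Q_j^1$ of side $(1-\delta)/2$; their union is $E^1$. Inductively, at stage $k$ replace each of the $2^{n(k-1)}$ cubes of $E^{k-1}$ by its $2^n$ (half-open) corner cubes $Q_j^k$ of side $((1-\delta)/2)^k$; the union of these $2^{nk}$ cubes is $E^k$. The Cantor family $\mathcal{S}_0=\{Q_j^k\}_{j,k}$ consists of all cubes of all stages $k\ge0$ (including $Q_0$). A family $\mathcal{S}$ of half-open cubes is $\eta$-sparse ($0<\eta<1$) if for every $Q\in\mathcal{S}$ there is a measurable $E_Q\subset Q$ with $|E_Q|\ge\eta|Q|$ and the sets $E_Q$, $Q\in\mathcal{S}$,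 are pairwise disjoint. ($\mathcal{S}_0$ is sparse with $\eta=1-(1-\delta)^n$.) The associated sparse operator is $\mathcal{A}_{\mathcal{S}}f(x)=\sum_{Q\in\mathcal{S}}\left(\frac1{|Q|}\int_Qf\,dy\right)\mathbf{1}_Q(x)$. *)

(* Defs.v *)
From HB Require Import structures.
From mathcomp Require Import all_boot all_order all_algebra.
From mathcomp Require Import all_classical all_reals all_analysis.
Import Order.TTheory GRing.Theory Num.Theory.
Import numFieldNormedType.Exports.

Set Implicit Arguments.
Unset Strict Implicit.
Unset Printing Implicit Defensive.

Local Open Scope classical_set_scope.
Local Open Scope ring_scope.

(* Lebesgue measure on R^n = 'rV[R]_n, obtained by Caratheodory's construction
   from the coverings by countably many half-open boxes; a box is given by its
   two extreme corners. *)
Section lebesgue_rV.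
Context {R : realType} {n : nat}.
Local Open Scope ereal_scope.

Definition box (b : 'rV[R]_n * 'rV[R]_n) : set 'rV[R]_n :=
  [set x | forall i, (b.1 ord0 i <= x ord0 i < b.2 ord0 i)%R].

Definition box_volume (b : 'rV[R]_n * 'rV[R]_n) : R :=
  (\prod_(i < n) Num.max 0 (b.2 ord0 i - b.1 ord0 i))%R.

Definition lebesgue_outer (E : set 'rV[R]_n) : \bar R :=
  ereal_inf [set \esum_(b in B) (box_volume b)%:E
    | B in [set B | countable B /\ E `<=` \bigcup_(b in B) box b]].

Lemma box_volume_ge0 b : (0 <= box_volume b)%R.
Proof. by apply: prodr_ge0 => i _; rewrite le_max lexx. Qed.

Let lebesgue_outer_ge0 E : 0 <= lebesgue_outer E.
Proof.
apply: le_ereal_inf_tmp => _ [B _ <-]; apply: esum_ge0 => b _.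
by rewrite lee_fin box_volume_ge0.
Qed.

Let lebesgue_outer0 : lebesgue_outer set0 = 0.
Proof.
apply/eqP; rewrite eq_le lebesgue_outer_ge0 andbT.
apply: ereal_inf_lbound; exists set0; last by rewrite esum_set0.
by split; [exact: countable0|exact: sub0set].
Qed.

Let le_lebesgue_outer : {homo lebesgue_outer : A B / A `<=` B >-> A <= B}.
Proof.
move=> E F EF; apply: ereal_inf_le_tmp => _ [B [cB FB] <-].
by exists B => //; split => //; exact: subset_trans FB.
Qed.

Let esum_bigcup_le (C : (set ('rV[R]_n * 'rV[R]_n))^nat) :
  \esum_(b in \bigcup_k C k) (box_volume b)%:E <=
  \sum_(k <oo) \esum_(b in C k) (box_volume b)%:E.
Proof.
have v0 (b : 'rV[R]_n * 'rV[R]_n) : 0 <= (box_volume b)%:E.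
  by rewrite lee_fin box_volume_ge0.
rewrite seqDU_bigcup_eq (esum_bigcupT _ _ (trivIset_seqDU C))//.
have es0 (X : set ('rV[R]_n * 'rV[R]_n)) : 0 <= \esum_(b in X) (box_volume b)%:E.
  by apply: esum_ge0 => b _; exact: v0.
rewrite -nneseries_esumT//.
apply: lee_nneseries => // k _.
apply: ereal_sup_le => _ [X [fX Xk] <-]; exists X => //; split => //.
by apply: subset_trans Xk _; exact: subset_seqDU.
Qed.

Let lebesgue_outer_sigma_subadditive : sigma_subadditive lebesgue_outer.
Proof.
move=> F; have [[i ioo]|] := pselect (exists i, lebesgue_outer (F i) = +oo).
  rewrite (eseries_pinfty _ _ ioo) ?leey// => k _.
  by rewrite -ltNye (lt_le_trans _ (lebesgue_outer_ge0 _)).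
rewrite -forallNE => Foo; apply/lee_addgt0Pr => e e0.
rewrite (le_trans _ (epsilon_trick _ _ (ltW e0)))//.
pose P k (B : set ('rV[R]_n * 'rV[R]_n)) :=
  (countable B /\ F k `<=` \bigcup_(b in B) box b) /\
  \esum_(b in B) (box_volume b)%:E <=
    lebesgue_outer (F k) + (e / (2 ^ k.+1)%:R)%:E.
have [C PC] : {C : nat -> set ('rV[R]_n * 'rV[R]_n) & forall k, P k (C k)}.
  apply: choice => k.
  have ffin : lebesgue_outer (F k) \is a fin_num.
    by rewrite ge0_fin_numE ?lebesgue_outer_ge0// ltey; apply/eqP; exact: Foo.
  have ek : (0 < e / (2 ^ k.+1)%:R)%R by rewrite divr_gt0// ltr0n expn_gt0.
  have [_ [B PB <-] /ltW ?] := lb_ereal_inf_adherent ek ffin.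
  by exists B.
apply: (@le_trans _ _ (\esum_(b in \bigcup_k C k) (box_volume b)%:E)).
  apply: ereal_inf_lbound; exists (\bigcup_k C k) => //; split.
    by apply: bigcup_countable => // k _; exact: (PC k).1.1.
  move=> x [k _ /(PC k).1.2[b Cb xb]]; exists b => //; by exists k.
apply: (le_trans (esum_bigcup_le C)); apply: lee_nneseries => k _.
  by move=> _; apply: esum_ge0 => b _; rewrite lee_fin box_volume_ge0.
exact: (PC k).2.
Qed.

HB.instance Definition _ := isOuterMeasure.Build R 'rV[R]_n lebesgue_outer
  lebesgue_outer0 lebesgue_outer_ge0 le_lebesgue_outer
  lebesgue_outer_sigma_subadditive.

End lebesgue_rV.

Notation lebesgueType R n := (caratheodory_type (@lebesgue_outer R n)).

Definition lebesgue_rV {R : realType} {n : nat} (E : set (lebesgueType R n)) :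
  \bar R := lebesgue_outer (E : set 'rV[R]_n).

HB.instance Definition _ (R : realType) (n : nat) :=
  isMeasure.Build _ (lebesgueType R n) R (@lebesgue_rV R n)
    (@caratheodory_measure0 R _ (@lebesgue_outer R n))
    (@caratheodory_measure_ge0 R _ (@lebesgue_outer R n))
    (@caratheodory_measure_sigma_additive R _ (@lebesgue_outer R n)).

Definition locally_integrable_rV {R : realType} {n : nat} (f : 'rV[R]_n -> R) :=
  measurable_fun [set: lebesgueType R n] (f : lebesgueType R n -> R) /\
  forall K : set 'rV[R]_n, compact K ->
    (\int[lebesgue_rV]_(x in (K : set (lebesgueType R n))) `|f x|%:E < +oo)%E.

Section cubes.
Context {R : realType} {n : nat}.

(* The pair (a, l) encodes the half-open cube a + [0, l)^n; for l > 0 and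
   n >= 1 distinct pairs give distinct cubes. *)
Definition cube (Q : 'rV[R]_n * R) : set 'rV[R]_n :=
  box (Q.1, Q.1 + const_mx Q.2).

(* (k, j) is the index of 2^-k (j + [0, 1)^n). *)
Definition dyadic (i : int * 'rV[int]_n) : 'rV[R]_n * R :=
  let l := (2 : R) ^ (- i.1) in (l *: map_mx intr i.2, l).

(* The index type of the dyadic cubes being countable, an arbitrary set of
   indices is a countable family of dyadic cubes. *)
Definition dyadic_content (d : R) (E : set 'rV[R]_n) : \bar R :=
  ereal_inf [set (\esum_(i in I) ((dyadic i).2 `^ d)%:E)%E
    | I in [set I | E `<=` \bigcup_(i in I) cube (dyadic i)]].

End cubes.

Section choquet.
Context {R : realType} {n : nat}.
Local Open Scope ereal_scope.

Definition choquet_integral (d : R) (f : 'rV[R]_n -> \bar R) : \bar R :=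
  \int[lebesgue_measure]_(t in `]0%R, +oo[) dyadic_content d [set x | t%:E < f x].

Definition choquet_norm (d p : R) (f : 'rV[R]_n -> \bar R) : \bar R :=
  choquet_integral d (fun x => `|f x| `^ p) `^ p^-1.

Definition C0 (f : 'rV[R]_n -> R) :=
  continuous f /\ compact (closure [set x | f x != 0%R]).

(* The completion of C0, realized as a space of functions: those which are
   limits of functions in C0. The Choquet integral for the dyadic content being
   sublinear, choquet_norm is the continuous extension to this space of its
   restriction to C0. *)
Definition choquet_space (d p : R) (f : 'rV[R]_n -> R) :=
  forall e : R, (0 < e)%R -> exists2 g, C0 g &
    choquet_norm d p (fun x => (f x - g x)%:E) < e%:E.

End choquet.

Section sparse.
Context {R : realType} {n : nat}.

Definition average (f : 'rV[R]_n -> R) (Q : 'rV[R]_n * R) : R :=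
  (fine (lebesgue_rV (cube Q : set (lebesgueType R n))))^-1 *
  \int[lebesgue_rV]_(y in (cube Q : set (lebesgueType R n))) f y.

(* The sum over the family is the difference of the sums of the positive and
   of the negative parts. When both are infinite the value is -oo. The choice
   of that value is immaterial for boundedness: whatever it is, the absolute
   value of the sum for f is at most the sum for |f|, and |f| has the same norm
   as f. *)
Definition sparse_operator (S : set ('rV[R]_n * R)) (f : 'rV[R]_n -> R)
    (x : 'rV[R]_n) : \bar R :=
  let term Q := (average f Q * \1_(cube Q) x)%:E in
  (\esum_(Q in S) term^\+ Q - \esum_(Q in S) term^\- Q)%E.

End sparse.

Section cantor_construction.
Context {R : realType} (n : nat) (delta : R).

(* e selects a corner of Q: one of the two ends of Q along each axis *)
Definition corner_cubes (Q : 'rV[R]_n * R) : set ('rV[R]_n * R) :=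
  let l := (1 - delta) / 2 * Q.2 in
  [set (\row_i (Q.1 ord0 i + (e i)%:R * (Q.2 - l)), l)
    | e in [set: {ffun 'I_n -> bool}]].

Fixpoint cantor_cubes (k : nat) : set ('rV[R]_n * R) :=
  if k is k'.+1 then \bigcup_(Q in cantor_cubes k') corner_cubes Q
  else [set (0, 1)].

Definition cantor_step (k : nat) : set 'rV[R]_n :=
  \bigcup_(Q in cantor_cubes k) cube Q.

Definition cantor_family : set ('rV[R]_n * R) := \bigcup_k cantor_cubes k.

End cantor_construction.

Arguments cantor_cubes {R} n delta k.
Arguments cantor_step {R} n delta k.
Arguments cantor_family {R} n delta.

(* Main.v *)
Require Import Defs.
From mathcomp Require Import all_boot all_order all_algebra.
From mathcomp Require Import all_classical all_reals all_analysis.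
From mathcomp Require Import measurable_realfun ring lra.
Import Order.TTheory GRing.Theory Num.Theory.
Import numFieldNormedType.Exports.
Local Open Scope classical_set_scope.
Local Open Scope ring_scope.

(** Put lam = (1 - delta) / 2. The equation on delta says that
    2 ^ n * lam ^ d = 1, that is, d is the similarity dimension of the Cantor
    construction.

    Upper bound: the step E^k is a union of 2 ^ (n k) cubes of side lam ^ k, and
    a cube of side l meets at most 2 ^ n dyadic cubes of side comparable to l,
    so the total cost is of order 2 ^ (n k) * lam ^ (k d) = 1.

    Lower bound (cantor_cover_lower_bound): any countable family of cubes, of
    arbitrary position and side, that covers E^k has sum of the l_i ^ d at least
    delta ^ d. The set E^(k+1) contains the 2 ^ n images of E^k under the
    contractions x |-> lam x + (1 - lam) e, for e a vertex of the unit cube.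
    These images lie at mutual distance at least delta. If some cube has side at
    least delta there is nothing to prove. Otherwise each cube meets at most one
    image; rescaling the cubes that meet a given image, the induction hypothesis
    bounds their sum below by lam ^ d * delta ^ d, and adding over the images
    multiplies this by 2 ^ n. For k = 0 the sides are below 1, so l_i ^ d is at
    least l_i ^ n and the bound is the countable subadditivity of volume.

    Unboundedness: a single function refutes every constant and every exponent.
    Take a continuous compactly supported function equal to 1 on the unit cube.
    Its averages over the cubes of the Cantor family are all 1, so the sparse
    operator sends it to a function that is at least k + 1 on E^k. As the
    contents of the E^k are bounded below, all superlevel sets of the image have
    content at least c > 0, and its Choquet norm is infinite, while that of the
    function itself is finite. The averages make sense because Lebesgue measure
    of a box is its volume, which needs the covering bound volume_le_weighted. *)

(** * Unconditional sums *)

Lemma subset_esum (R : realType) (T : choiceType) (A B : set T)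
    (f : T -> \bar R) :
  A `<=` B -> (\esum_(i in A) f i <= \esum_(i in B) f i)%E.
Proof.
move=> AB; apply: ereal_sup_le => _ [X [finX XA] <-].
by exists X => //; split => //; exact: subset_trans AB.
Qed.

Lemma esum_setU_le (R : realType) (T : choiceType) (A B : set T)
    (f : T -> \bar R) : (forall i, 0 <= f i)%E ->
  (\esum_(i in A `|` B) f i <= \esum_(i in A) f i + \esum_(i in B) f i)%E.
Proof.
move=> f0; rewrite (esumID A)//; apply: leeD; apply: subset_esum.
  by move=> x [].
by move=> x [[]].
Qed.

Lemma esumZ_le (R : realType) (T : choiceType) (I : set T) (f : T -> \bar R) (c : R) :
  0 <= c -> (forall i, 0 <= f i)%E ->
  (\esum_(i in I) (c%:E * f i) <= c%:E * \esum_(i in I) f i)%E.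
Proof.
move=> c0 f0; apply: ge_ereal_sup => _ [X [finX XI] <-].
rewrite -ge0_mule_fsumr//; apply: lee_wpmul2l; first by rewrite lee_fin.
by apply: ereal_sup_ubound; exists X.
Qed.

Lemma image_section (T T' : Type) (P : set T) (e : T -> T') (x0 : T) :
  exists g : T' -> T, forall y, (e @` P) y -> P (g y) /\ e (g y) = y.
Proof.
have [g gP] : {g : T' -> T & forall y, (e @` P) y -> P (g y) /\ e (g y) = y}.
  apply: (@choice _ _ (fun y x => (e @` P) y -> P x /\ e x = y)) => y.
  have [[x Px <-]|nPy] := pselect ((e @` P) y); first by exists x.
  by exists x0.
by exists g.
Qed.

(** Only an inequality, since e may identify indices; a section of e picks one
    index for each point of the image. *)
Lemma esum_image_le (R : realType) (T T' : choiceType) (P : set T)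
    (e : T -> T') (f : T' -> \bar R) : (forall i, 0 <= f i)%E ->
  (\esum_(j in e @` P) f j <= \esum_(i in P) f (e i))%E.
Proof.
move=> f0; have [[x0 _]|P0] := pselect (P !=set0); last first.
  have -> : P = set0 by apply/eqP/negPn/negP => /set0P.
  by rewrite image_set0 !esum_set0.
have [g gP] := image_section _ _ P e x0.
rewrite (eq_esum (b := fun y => f (e (g y)))); last by move=> y /gP[_ ->].
rewrite -(esum_image (e @` P) g (f \o e)).
  by apply: subset_esum => _ [y /gP[? _] <-].
move=> y y' /set_mem /gP[_ yE] /set_mem /gP[_ y'E] gg.
by rewrite -yE -y'E gg.
Qed.

Lemma countable_esum (R : realType) (T : choiceType) (I : set T)
    (f : T -> \bar R) (t0 : T) : countable I -> (forall i, 0 <= f i)%E ->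
  exists (J : set nat) (g : nat -> T), set_bij J I g /\
  \esum_(i in I) f i = (\sum_(k <oo | k \in J) f (g k))%E.
Proof.
move=> /countable_injP[h hinj] f0; have [g gP] := image_section _ _ I h t0.
have gbij : set_bij (h @` I) I g.
  split; first by move=> y /gP[].
    move=> y y' /set_mem /gP[_ yE] /set_mem /gP[_ y'E] gg.
    by rewrite -yE -y'E gg.
  move=> x Ix; exists (h x); first by exists x.
  have [Ig hg] := gP _ (imageP h Ix).
  by apply: hinj => //; exact/mem_set.
exists (h @` I), g; split => //.
by rewrite (reindex_esum _ _ _ _ gbij) nneseries_esum// set_mem_set.
Qed.

(** The function on n + 1 coordinates with head t and tail x. *)
Definition fcons (R : Type) (n : nat) (t : R) (x : 'I_n -> R) (i : 'I_n.+1) :=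
  oapp x t (unlift ord0 i).

(** Countable subadditivity of volume, by Tonelli's theorem one coordinate at a
    time, hence without a compactness argument. The weights make the induction
    work: when the first coordinate is fixed to t, the boxes whose first side
    misses t must disappear, which amounts to multiplying w j by the indicator
    of that side; integrating in t then restores the length of the side. *)
Lemma volume_le_weighted (R : realType) (n : nat) (a b : 'I_n -> R)
    (A B : nat -> 'I_n -> R) (w : nat -> R) :
  (forall j, 0 <= w j) ->
  (forall x : 'I_n -> R, (forall i, a i <= x i < b i) ->
    (1 <= \sum_(j <oo) (w j * \prod_i (A j i <= x i < B j i)%R%:R)%:E)%E) ->
  ((\prod_i Num.max 0 (b i - a i))%:E <=
   \sum_(j <oo) (w j * \prod_i Num.max 0 (B j i - A j i))%:E)%E.
Proof.
elim: n a b A B w => [|n IH] a b A B w w0 cov.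
  have /cov : forall i : 'I_0, a i <= a i < b i by case.
  rewrite big_ord0 => /le_trans; apply; rewrite le_eqVlt; apply/orP; left.
  by apply/eqP/eq_eseriesr => j _; rewrite !big_ord0.
pose V j := \prod_i Num.max 0 (B j (lift ord0 i) - A j (lift ord0 i)).
have V0 j : 0 <= V j by apply: prodr_ge0 => i _; rewrite le_max lexx.
have slice t : a ord0 <= t < b ord0 ->
    ((\prod_i Num.max 0 (b (lift ord0 i) - a (lift ord0 i)))%:E <=
    \sum_(j <oo) (w j * (A j ord0 <= t < B j ord0)%R%:R * V j)%:E)%E.
  move=> tab; apply: (IH (a \o lift ord0) (b \o lift ord0)
    (fun j => A j \o lift ord0) (fun j => B j \o lift ord0)).
    by move=> j; rewrite mulr_ge0.
  move=> x xab /=; have /cov : forall i, a i <= fcons _ _ t x i < b i.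
    move=> i; rewrite /fcons; case: unliftP => [k ->|->] //=; exact: xab.
  move=> /le_trans; apply; rewrite le_eqVlt; apply/orP; left.
  apply/eqP/eq_eseriesr => j _; rewrite big_ord_recl mulrA /fcons unlift_none.
  by congr (_ * _)%:E; apply: eq_bigr => i _; rewrite liftK.
set v := \prod_(i < n) _ in slice.
have lenE (x y : R) : lebesgue_measure `[x, y[%classic = (Num.max 0 (y - x))%:E.
  rewrite lebesgue_measure_itv/= lte_fin; case: ltP => xy.
    by rewrite max_r// subr_ge0 ltW.
  by rewrite max_l// subr_le0.
rewrite big_ord_recl -/v mulrC EFinM -lenE.
have v0 : 0 <= v by apply: prodr_ge0 => i _; rewrite le_max lexx.
rewrite -(@integral_cst _ _ _ lebesgue_measure)//.
pose F j t : \bar R := (w j * V j * \1_(`[A j ord0, B j ord0[%classic) t)%:E.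
have F0 j t : (0 <= F j t)%E by rewrite lee_fin !mulr_ge0.
have mF j (D : set R) : measurable_fun D (F j).
  by apply/measurable_EFinP; apply: measurable_funM => //; exact: measurable_indic.
(* integrate the inequality slice over the first side of the covered box *)
apply: (@le_trans _ _
  (\int[lebesgue_measure]_(t in `[a ord0, b ord0[) \sum_(j <oo) F j t)%E).
  apply: ge0_le_integral => //=.
    apply: ge0_emeasurable_sum => [k x _ _|k _]; [exact: F0|exact: mF].
  move=> t tab; have := slice t; rewrite in_itv/= in tab => /(_ tab) /le_trans; apply.
  rewrite le_eqVlt; apply/orP; left; apply/eqP/eq_eseriesr => j _.
  rewrite /F indicE mulrAC; do 3 f_equal.
  by rewrite mem_setE in_itv.
rewrite integral_nneseries//; last by move=> k; exact: mF.
apply: lee_nneseries => j _; first by move=> _; apply: integral_ge0.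
rewrite /F; under eq_integral do rewrite EFinM.
rewrite ge0_integralZl_EFin//; last 2 first.
- by apply/measurable_EFinP; exact: measurable_indic.
- by rewrite mulr_ge0.
rewrite integral_indic// big_ord_recl -/(V j) [_ * V j]mulrC mulrA.
rewrite -[leLHS]/((w j * V j)%:E * _)%E [leRHS]EFinM -lenE.
apply: lee_wpmul2l; first by rewrite lee_fin mulr_ge0.
by apply: le_measure; rewrite ?inE//=; exact: measurableI.
Qed.

(** * Lebesgue measure of boxes *)

Section lebesgue.
Context (R : realType) (n : nat).
Implicit Types (b : 'rV[R]_n * 'rV[R]_n).

Lemma cubeP (Q : 'rV[R]_n * R) x :
  cube Q x <-> forall i, Q.1 ord0 i <= x ord0 i < Q.1 ord0 i + Q.2.
Proof. by split => h i; have := h i; rewrite !mxE. Qed.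

Lemma box_volume_cube (Q : 'rV[R]_n * R) : 0 <= Q.2 ->
  box_volume (Q.1, Q.1 + const_mx Q.2) = Q.2 ^+ n.
Proof.
move=> Q0; rewrite /box_volume (eq_bigr (fun=> Q.2)) => [|i _].
  by rewrite prodr_const card_ord.
by rewrite !mxE addrAC subrr add0r max_r.
Qed.

Lemma box_volume_le_esum (T : choiceType) (I : set T)
    (q : T -> 'rV[R]_n * 'rV[R]_n) b : countable I ->
  box b `<=` \bigcup_(i in I) box (q i) ->
  ((box_volume b)%:E <= \esum_(i in I) (box_volume (q i))%:E)%E.
Proof.
move=> cI bq.
(* a box of positive volume contains its lower corner, so is not covered by an
   empty family *)
have [[t0 _]|I0] := pselect (I !=set0); last first.
  have E : I = set0 by apply/eqP/negPn/negP => /set0P.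
  rewrite E esum_set0 lee_fin leNgt; apply/negP => b0.
  have : box b b.1.
    move=> i; rewrite lexx/= ltNge; apply/negP => bi.
    move: b0; rewrite /box_volume (bigD1 i)//= max_l ?mul0r ?ltxx//.
    by rewrite subr_le0.
  by move/bq => [i]; rewrite E.
have [J [g [[gI _ gs] ->]]] := @countable_esum _ _ I
  (fun i => (box_volume (q i))%:E) t0 cI (fun i => box_volume_ge0 _).
pose w j : R := (j \in J)%:R.
have -> : (\sum_(k <oo | k \in J) (box_volume (q (g k)))%:E =
  \sum_(k <oo) (w k * box_volume (q (g k)))%:E)%E.
  rewrite eseries_mkcond; apply: eq_eseriesr => k _.
  by rewrite /w; case: ifP => _; rewrite ?mul1r ?mul0r.
apply: (@volume_le_weighted R n (fun i => b.1 ord0 i) (fun i => b.2 ord0 i)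
  (fun j i => (q (g j)).1 ord0 i) (fun j i => (q (g j)).2 ord0 i) w).
  by move=> j; rewrite ler0n.
move=> x xb.
have /bq[i Ii qx] : box b (\row_i x i) by move=> i; rewrite mxE; exact: xb.
have [j Jj gji] := gs i Ii.
pose u k := (w k * \prod_i ((q (g k)).1 ord0 i <= x i < (q (g k)).2 ord0 i)%R%:R)%:E.
have u0 k : (0 <= u k)%E by rewrite lee_fin mulr_ge0// prodr_ge0.
rewrite -/(u _).
rewrite nneseries_esumT//; apply: esum_ge; exists [set j].
  by split => //; exact: finite_set1.
rewrite fsbig_set1 /u /w mem_set// mul1r big1// => k _.
by have := qx k; rewrite mxE gji => ->.
Qed.

Lemma lebesgue_outer_box b : lebesgue_outer (box b) = (box_volume b)%:E.
Proof.
apply/eqP; rewrite eq_le; apply/andP; split.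
  apply: ereal_inf_lbound; exists [set b].
    by split; [exact: countable1|move=> x bx; exists b].
  by rewrite esum_set1// lee_fin box_volume_ge0.
apply: le_ereal_inf_tmp => _ [B [cB bB] <-].
exact: (@box_volume_le_esum _ B id).
Qed.

(** The two pieces into which the hyperplane x i = a cuts the box b. *)
Definition clip_hi (i : 'I_n) (a : R) b : 'rV[R]_n * 'rV[R]_n :=
  (b.1, \row_j (if j == i then Num.min a (b.2 ord0 j) else b.2 ord0 j)).
Definition clip_lo (i : 'I_n) (a : R) b : 'rV[R]_n * 'rV[R]_n :=
  (\row_j (if j == i then Num.max a (b.1 ord0 j) else b.1 ord0 j), b.2).

Lemma box_volume_clip i a b :
  box_volume (clip_hi i a b) + box_volume (clip_lo i a b) <= box_volume b.
Proof.
have split_i c : box_volume c = Num.max 0 (c.2 ord0 i - c.1 ord0 i) *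
    \prod_(j < n | j != i) Num.max 0 (c.2 ord0 j - c.1 ord0 j).
  by rewrite /box_volume (bigD1 i).
rewrite !split_i/= !mxE eqxx.
set p := \prod_(j < n | j != i) _.
set p1 := \prod_(j < n | j != i) _.
set p2 := \prod_(j < n | j != i) _.
have -> : p = p2 by apply: eq_bigr => j /negPf ji; rewrite mxE ji.
have -> : p1 = p2 by apply: eq_bigr => j /negPf ji; rewrite mxE ji.
rewrite -mulrDl ler_wpM2r//.
  by apply: prodr_ge0 => j _; rewrite le_max lexx.
rewrite /Num.max /Num.min; do ![case: ifPn => //=];
  rewrite -?leNgt => *; lra.
Qed.

(** Cutting each box of a covering of X along the hyperplane gives coverings of
    the two parts of X with no more total volume. *)
Lemma measurable_halfspace i (a : R) :
  measurable ([set x | x ord0 i < a] : set (lebesgueType R n)).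
Proof.
apply: le_caratheodory_measurable => /= X.
apply: le_ereal_inf_tmp => _ [B [cB XB] <-].
have v0 b : (0 <= (box_volume b)%:E)%E by rewrite lee_fin box_volume_ge0.
apply: (@le_trans _ _ (\esum_(b in B) (box_volume (clip_hi i a b))%:E +
  \esum_(b in B) (box_volume (clip_lo i a b))%:E)%E); last first.
  rewrite -esumD//; apply: le_esum => b _.
  by rewrite -EFinD lee_fin box_volume_clip.
apply: leeD; (apply: le_trans; last exact: (@esum_image_le _ _ _ B _ _ v0)).
- apply: ereal_inf_lbound; exists (clip_hi i a @` B) => //.
  split; first exact: card_le_trans (card_image_le _ _) cB.
  move=> x [/XB[b Bb bx] xa]; exists (clip_hi i a b); first by exists b.
  move=> j; rewrite mxE; have := bx j => /andP[-> ?] /=.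
  by case: ifP => // /eqP ->; rewrite lt_min xa; have /andP[] := bx i.
- apply: ereal_inf_lbound; exists (clip_lo i a @` B) => //.
  split; first exact: card_le_trans (card_image_le _ _) cB.
  move=> x [/XB[b Bb bx] xa]; exists (clip_lo i a b); first by exists b.
  move=> j; rewrite mxE; have := bx j => /andP[? ->]; rewrite andbT.
  case: ifP => // /eqP ->; rewrite ge_max; have /andP[-> _] := bx i.
  by rewrite andbT leNgt; exact/negP.
Qed.

Lemma measurable_coord i :
  measurable_fun setT ((fun x => x ord0 i) : lebesgueType R n -> R).
Proof.
apply: (measurability _ (RGenInftyO.measurableE R)) => _ [_ [a ->] <-].
rewrite setTI; have -> : (fun x : lebesgueType R n => x ord0 i) @^-1` `]-oo, a[
    = [set x | x ord0 i < a].
  by apply/seteqP; split => x /=; rewrite in_itv.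
exact: measurable_halfspace.
Qed.

Lemma measurable_box b : measurable (box b : set (lebesgueType R n)).
Proof.
have -> : box b = \bigcap_(i in [set: 'I_n])
   ((fun x : lebesgueType R n => x ord0 i) @^-1` `[b.1 ord0 i, b.2 ord0 i[).
  apply/seteqP; split => x bx i; first by move=> _; rewrite /= in_itv/=; exact: bx.
  by have := bx i I; rewrite /= in_itv.
apply: fin_bigcap_measurable; first exact: finite_finset.
move=> i _; rewrite -[X in measurable X]setTI; exact: measurable_coord.
Qed.
End lebesgue.

(** * Coverings of the Cantor steps *)

Lemma powRV (R : realType) (a r : R) : 0 <= a -> a^-1 `^ r = (a `^ r)^-1.
Proof. by move=> a0; rewrite -powRN -powR_inv1// -powRrM mulN1r. Qed.

Section cantor.
Context (R : realType) (n : nat) (d delta : R).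
Context (delta_gt0 : 0 < delta) (delta_lt1 : delta < 1).
Let lam : R := (1 - delta) / 2.

Let lam_gt0 : 0 < lam. Proof. by rewrite /lam; move: delta_lt1; lra. Qed.
Let lam_lt1 : lam < 1. Proof. by rewrite /lam; move: delta_gt0 delta_lt1; lra. Qed.

Lemma cantor_cubes_side k Q : cantor_cubes n delta k Q -> Q.2 = lam ^+ k.
Proof.
elim: k Q => [Q ->|k IH Q [Q' Q'k [e _ <-]]] //=.
by rewrite (IH Q')// exprS.
Qed.

Lemma cube_corner (Q Q' : 'rV[R]_n * R) :
  0 <= Q.2 -> corner_cubes delta Q Q' -> cube Q' `<=` cube Q.
Proof.
move=> Q0 [e _ <-] x /cubeP xQ'; apply/cubeP => i; have := xQ' i.
rewrite mxE/= -/lam => /andP[h1 h2].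
have : 0 <= lam * Q.2 by rewrite mulr_ge0// ltW.
have : lam * Q.2 <= Q.2 by rewrite ler_piMl// ltW.
by move: h1 h2; case: (e i); rewrite /= ?mulr1n ?mulr0n ?mul1r ?mul0r => h1 h2 h3 h4;
  apply/andP; split; lra.
Qed.

Lemma cantor_step_decr k : cantor_step n delta k.+1 `<=` cantor_step n delta k.
Proof.
move=> x [Q' [Q Qk QQ'] xQ']; exists Q => //; apply: cube_corner QQ' _ xQ'.
by rewrite (cantor_cubes_side k)// exprn_ge0// ltW.
Qed.

Lemma cantor_step_nonincreasing j k : (j <= k)%N ->
  cantor_step n delta k `<=` cantor_step n delta j.
Proof.
elim: k => [|k IH]; first by rewrite leqn0 => /eqP ->.
rewrite leq_eqVlt => /predU1P[->//|/IH]; apply: subset_trans.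
exact: cantor_step_decr.
Qed.

Lemma cantor_step0 : cantor_step n delta 0 = cube (0, 1).
Proof. by rewrite /cantor_step bigcup_set1. Qed.

(** The contraction of ratio lam that maps the unit cube to its corner cube at
    the vertex e. *)
Definition shrink (e : {ffun 'I_n -> bool}) (x : 'rV[R]_n) : 'rV[R]_n :=
  \row_i (lam * x ord0 i + (e i)%:R * (1 - lam)).

(** The construction passes to corners of the cubes of the last stage; this is
    the self-similar description, where the whole of stage k is contracted into
    a corner of the unit cube. It holds because taking corner cubes commutes
    with homotheties. *)
Lemma cantor_cubes_shrink k e Q : cantor_cubes n delta k Q ->
  cantor_cubes n delta k.+1 (shrink e Q.1, lam * Q.2).
Proof.
elim: k Q => [Q ->|k IH Q [Q' Q'k [e' _ <-]]].
  exists (0, 1) => //; exists e => //=; rewrite -/lam; congr (_, _).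
  by apply/rowP => i; rewrite !mxE mulr0 mulr1.
exists (shrink e Q'.1, lam * Q'.2); first exact: IH.
exists e' => //=; rewrite -/lam; congr (_, _).
by apply/rowP => i; rewrite !mxE; ring.
Qed.

Lemma cantor_step_shrink k e x :
  cantor_step n delta k x -> cantor_step n delta k.+1 (shrink e x).
Proof.
move=> [Q Qk /cubeP xQ]; exists (shrink e Q.1, lam * Q.2).
  exact: cantor_cubes_shrink.
apply/cubeP => i; rewrite !mxE/= addrAC -mulrDr lerD2r ltrD2r.
by rewrite ler_pM2l// ltr_pM2l.
Qed.

(** Along an axis where e and e' differ, one image lies in [0, lam) and the other
    in [1 - lam, 1), and the gap between them is 1 - 2 lam = delta. *)
Lemma shrink_separated (e e' : {ffun 'I_n -> bool}) x x' Q :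
  cube (0, 1) x -> cube (0, 1) x' -> Q.2 < delta ->
  cube Q (shrink e x) -> cube Q (shrink e' x') -> e = e'.
Proof.
move=> /cubeP x01 /cubeP x'01 Qd /cubeP Qx /cubeP Qx'; apply/ffunP => i.
have := x01 i; have := x'01 i; have := Qx i; have := Qx' i.
rewrite !mxE/= !add0r.
move=> /andP[a1 a2] /andP[b1 b2] /andP[c1 c2] /andP[d1 d2].
have c3 : 0 <= lam * x' ord0 i by rewrite mulr_ge0// ltW.
have c4 : lam * x' ord0 i < lam by rewrite gtr_pMr.
have d3 : 0 <= lam * x ord0 i by rewrite mulr_ge0// ltW.
have d4 : lam * x ord0 i < lam by rewrite gtr_pMr.
have dE : delta = 1 - lam *+ 2 by rewrite /lam; field.
by move: a1 a2 b1 b2; case: (e i); case: (e' i) => //=;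
  rewrite /= ?mulr1n ?mulr0n ?mul1r ?mul0r => *; exfalso; lra.
Qed.

Context (d_gt0 : 0 < d) (d_lt_n : d < n%:R).
Context (delta_d : 2 `^ (n%:R - d) * (1 - delta) `^ d = 1).

Lemma ratio_dimension : (2 ^ n)%:R * lam `^ d = 1.
Proof.
have c0 : 0 <= 1 - delta by rewrite subr_ge0 ltW.
rewrite -[RHS]delta_d /lam powRM// ?invr_ge0//.
rewrite powRV// -powRN powRD; last by rewrite pnatr_eq0 implybT.
by rewrite powR_mulrn// -natrX; ring.
Qed.

(** Arbitrary cubes are allowed, rather than only dyadic ones, so that the
    statement is stable under the inverse contractions used in the induction. *)
Lemma cantor_cover_lower_bound k (T : choiceType) (I : set T)
    (q : T -> 'rV[R]_n * R) :
  countable I -> (forall i, 0 < (q i).2) ->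
  cantor_step n delta k `<=` \bigcup_(i in I) cube (q i) ->
  ((delta `^ d)%:E <= \esum_(i in I) ((q i).2 `^ d)%:E)%E.
Proof.
move=> cI; elim: k I q cI => [|k IH] I q cI q0 cov;
  (have [[i [Ii di]]|small] := pselect (exists i, I i /\ delta <= (q i).2);
  [apply: esum_ge; exists [set i];
    [by split; [exact: finite_set1|move=> _ ->]|];
   rewrite fsbig_set1 lee_fin ge0_ler_powR// ?nnegrE ltW//
  |have {}small i : I i -> (q i).2 < delta by
     move=> Ii; rewrite ltNge; apply/negP => ?; apply: small; exists i]).
  rewrite cantor_step0 in cov.
  have := box_volume_le_esum _ _ _ _ _ _ cI cov.
  rewrite (box_volume_cube _ _ (0, 1))//= expr1n => h.
  apply: le_trans (le_trans h _).
    rewrite lee_fin (_ : 1 = 1 `^ d :> R); last by rewrite powR1.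
    by apply: ge0_ler_powR; rewrite ?nnegrE ?ltW.
  apply: le_esum => i Ii; rewrite lee_fin box_volume_cube ?(ltW (q0 _))//.
  rewrite -powR_mulrn ?(ltW (q0 _))//; apply: ger_powR; last exact: ltW.
  by rewrite q0 ltW//= (lt_trans (small i Ii)).
(* J e indexes the cubes that meet the image of the unit cube at the corner e,
   and q' e gives their preimages under that contraction *)
pose J e := I `&` [set i | exists x, cube (0, 1) x /\ cube (q i) (shrink e x)].
pose q' (e : {ffun 'I_n -> bool}) i : 'rV[R]_n * R :=
  (\row_j (((q i).1 ord0 j - (e j)%:R * (1 - lam)) / lam), (q i).2 / lam).
have J_lower e : (((lam * delta) `^ d)%:E <= \esum_(i in J e) ((q i).2 `^ d)%:E)%E.
  have lamd0 : 0 < lam `^ d by rewrite powR_gt0.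
  rewrite powRM ?(ltW lam_gt0) ?(ltW delta_gt0)// EFinM.
  have : ((delta `^ d)%:E <= \esum_(i in J e) ((q' e i).2 `^ d)%:E)%E.
    apply: (IH (J e) (q' e)).
    - by apply: sub_countable cI; apply: subset_card_le; exact: subIsetl.
    - by move=> i; rewrite divr_gt0.
    move=> x xk; have [i Ii xi] := cov _ (cantor_step_shrink k e x xk).
    exists i.
      split=> //; exists x; split=> //.
      by move: xk => /(cantor_step_nonincreasing 0); rewrite cantor_step0; apply.
    apply/cubeP => j; move: xi => /cubeP/(_ j); rewrite !mxE -mulrDl.
    by rewrite ler_pdivrMr// ltr_pdivlMr// lerBlDr addrAC ltrBrDr [x _ _ * _]mulrC.
  have -> : (\esum_(i in J e) ((q' e i).2 `^ d)%:E =
     \esum_(i in J e) (((lam `^ d)^-1)%:E * ((q i).2 `^ d)%:E))%E.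
    apply: eq_esum => i _; rewrite -EFinM /q'/= powRM ?invr_ge0 ?(ltW (q0 _)) ?(ltW lam_gt0)//.
    by rewrite mulrC powRV// ltW.
  have V0 : 0 <= (lam `^ d)^-1 by rewrite invr_ge0 ltW.
  rewrite -lee_pdivlMl// => /le_trans; apply; apply: esumZ_le => // i.
  by rewrite lee_fin powR_ge0.
have -> : (delta `^ d)%:E =
    (\sum_(e : {ffun 'I_n -> bool}) ((lam * delta) `^ d)%:E)%E.
  rewrite sumEFin sumr_const card_ffun card_bool card_ord -mulr_natl.
  by rewrite powRM ?(ltW lam_gt0) ?(ltW delta_gt0)// mulrA ratio_dimension mul1r.
apply: (@le_trans _ _
    (\sum_(e : {ffun 'I_n -> bool}) \esum_(i in J e) ((q i).2 `^ d)%:E)%E).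
  exact: lee_sum.
under eq_bigr do rewrite esum_mkcondr.
rewrite -esum_sum; last first.
  by move=> i e _ _; case: ifP => // _; rewrite lee_fin powR_ge0.
(* the cube q i is counted in J e for at most one e *)
apply: le_esum => i Ii.
have [[e0 [x [x01 qx]]]|none] := pselect (exists e x,
    cube (0, 1) x /\ cube (q i) (shrink e x)); last first.
  rewrite big1 => [|e _]; first by rewrite lee_fin powR_ge0.
  rewrite ifF//; apply/negbTE/negP => /set_mem ex.
  by apply: none; exists e.
rewrite (bigD1 e0)//= big1 => [|e ee0].
  by rewrite adde0; case: ifP => // _; rewrite lee_fin powR_ge0.
rewrite ifF//; apply/negbTE/negP => /set_mem[y [y01 qy]].
move/eqP: ee0; apply.
exact: (shrink_separated _ _ _ _ _ y01 x01 (small i Ii) qy qx).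
Qed.

Lemma cantor_content_lower_bound k :
  ((delta `^ d)%:E <= dyadic_content d (cantor_step n delta k))%E.
Proof.
apply: le_ereal_inf_tmp => _ [I cov <-].
apply: (cantor_cover_lower_bound k) cov; first exact: countableP.
by move=> i; rewrite /dyadic/= exprz_gt0.
Qed.
End cantor.

(** * Dyadic content of cubes and Cantor steps *)

Section content.
Context (R : realType) (n : nat) (d : R).
Implicit Types A B : set 'rV[R]_n.

Lemma dyadic_content_ge0 A : (0 <= dyadic_content d A)%E.
Proof.
apply: le_ereal_inf_tmp => _ [I _ <-]; apply: esum_ge0 => i _.
by rewrite lee_fin powR_ge0.
Qed.

Lemma le_dyadic_content A B :
  A `<=` B -> (dyadic_content d A <= dyadic_content d B)%E.
Proof.
move=> AB; apply: ereal_inf_le_tmp => _ [I BI <-].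
by exists I => //; exact: subset_trans BI.
Qed.

Lemma dyadic_content_setU_le A B (a b : R) :
  (dyadic_content d A <= a%:E)%E -> (dyadic_content d B <= b%:E)%E ->
  (dyadic_content d (A `|` B) <= (a + b)%:E)%E.
Proof.
move=> Aa Bb; apply/lee_addgt0Pr => e e0.
have approx C c : (dyadic_content d C <= c%:E)%E -> exists2 I,
    C `<=` \bigcup_(i in I) cube (dyadic i) &
    (\esum_(i in I) ((@dyadic R n i).2 `^ d)%:E <= (c + e / 2)%:E)%E.
  move=> Cc.
  have : (dyadic_content d C < (c + e / 2)%:E)%E.
    by rewrite (le_lt_trans Cc)// lte_fin ltrDl divr_gt0.
  by move=> /ereal_inf_lt[_ [I CI <-]] /ltW; exists I.
have [I AI Ia] := approx A a Aa; have [J BJ Jb] := approx B b Bb.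
apply: (@le_trans _ _ (\esum_(i in I `|` J) ((@dyadic R n i).2 `^ d)%:E)%E).
  apply: ereal_inf_lbound; exists (I `|` J) => // x.
  by case=> [/AI[i Ii ix]|/BJ[i Ji ix]]; exists i => //; [left|right].
apply: le_trans (esum_setU_le _ _ _ _ _ _) _.
  by move=> i; rewrite lee_fin powR_ge0.
by apply: le_trans (leeD Ia Jb) _; rewrite -!EFinD lee_fin; lra.
Qed.

Lemma dyadic_content_seq_le (T : eqType) (s : seq T) (A : T -> set 'rV[R]_n)
    (c : R) : (forall t, (dyadic_content d (A t) <= c%:E)%E) ->
  (dyadic_content d [set x | exists2 t, t \in s & A t x] <=
   ((size s)%:R * c)%:E)%E.
Proof.
move=> Ac; elim: s => [|t s IH].
  rewrite mul0r; apply: ereal_inf_lbound; exists set0; last by rewrite esum_set0.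
  by move=> x [].
rewrite /= -natr1 mulrDl mul1r; apply: le_trans (dyadic_content_setU_le _ _ _ _ IH (Ac t)).
apply: le_dyadic_content => x [u]; rewrite inE => /predU1P[->|us] Aux; first by right.
by left; exists u.
Qed.

Lemma dyadic_content_dyadic i :
  (dyadic_content d (cube (@dyadic R n i)) <= ((@dyadic R n i).2 `^ d)%:E)%E.
Proof.
apply: ereal_inf_lbound; exists [set i]; first by move=> x ix; exists i.
by rewrite esum_set1// lee_fin powR_ge0.
Qed.

Lemma exists_dyadic_length (l : R) : 0 < l ->
  exists k : int, l <= 2 ^ k <= 2 * l.
Proof.
move=> l0; have ln2_gt0 : 0 < ln 2 :> R by rewrite ln_gt0// ltr1n.
(* the ceiling of the logarithm of l in base 2 *)
exists (Num.ceil (ln l / ln 2)).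
set k := Num.ceil _.
have kE : 2 ^ k = expR (k%:~R * ln 2) :> R by rewrite -powR_intmul// /powR pnatr_eq0.
rewrite kE -[X in X <= _]lnK ?posrE// -[X in _ <= _ * X]lnK ?posrE//.
rewrite -[X in _ <= X * _]lnK ?posrE// -expRD !ler_expR.
rewrite -ler_pdivrMr// ceil_ge/=.
have : k%:~R < ln l / ln 2 + 1 by rewrite -ltrBlDr -[X in _ - X]/(1%:~R) -intrB ceilB1_lt.
by rewrite -(ltr_pM2r ln2_gt0) mulrDl divfK ?gt_eqF// mul1r addrC => /ltW.
Qed.

Context (d_ge0 : 0 <= d).

(** With 2 ^ k between l and 2 l, the projection of the cube to each axis meets
    at most two adjacent dyadic intervals of length 2 ^ k, so one bit per
    coordinate tells the dyadic cube that contains a given point. *)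
Lemma dyadic_content_cube_le (a : 'rV[R]_n) (l : R) : 0 < l ->
  (dyadic_content d (cube (a, l)) <= ((2 ^ n)%:R * (2 * l) `^ d)%:E)%E.
Proof.
move=> l0; have [k /andP[lk kl]] := exists_dyadic_length l l0.
set L : R := 2 ^ k in lk kl; have L0 : 0 < L by exact: exprz_gt0.
pose f i := Num.floor (a ord0 i / L).
pose idx (e : {ffun 'I_n -> bool}) : int * 'rV[int]_n :=
  (- k, \row_i (f i + (e i)%:R)).
have -> : (2 ^ n)%N = size (enum {ffun 'I_n -> bool}).
  by rewrite -cardE card_ffun card_bool card_ord.
apply: (le_trans _ (dyadic_content_seq_le _ (enum {ffun 'I_n -> bool})
  (fun e => cube (dyadic (idx e))) ((2 * l) `^ d) _)).
  apply: le_dyadic_content => x /cubeP xal.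
  pose e := [ffun i => L * ((f i)%:~R + 1) <= x ord0 i].
  exists e; first by rewrite mem_enum.
  apply/cubeP => i; rewrite /dyadic/= opprK -/L !mxE rmorphD/=.
  have := xal i => /= /andP[ax xl].
  have fa : L * (f i)%:~R <= a ord0 i.
    by rewrite mulrC -ler_pdivlMr// floor_le.
  have af : a ord0 i < L * ((f i)%:~R + 1).
    by rewrite mulrC -ltr_pdivrMr// -[X in _ + X]/(1%:~R) -intrD floorD1_gt.
  rewrite ffunE; case: (leP (L * ((f i)%:~R + 1))) => /= xf; rewrite ?(mulr1n, mulr0n, rmorph0, rmorph1);
    rewrite ?(addr0, mulrDr, mulr1) in af xf *; apply/andP; split; lra.
move=> e; apply: le_trans (dyadic_content_dyadic _) _.
rewrite /dyadic/= opprK lee_fin ge0_ler_powR// nnegrE ?(ltW L0)//.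
by rewrite mulr_ge0// ltW.
Qed.

End content.

Section cantor_upper.
Context (R : realType) (n : nat) (delta : R).
Let lam : R := (1 - delta) / 2.

Lemma cantor_cubes_enum k : exists2 s : seq ('rV[R]_n * R),
  size s = ((2 ^ n) ^ k)%N & forall Q, cantor_cubes n delta k Q -> Q \in s.
Proof.
elim: k => [|k [s sk ss]]; first by exists [:: (0, 1)] => // Q ->; rewrite mem_head.
pose corner (Q : 'rV[R]_n * R) (e : {ffun 'I_n -> bool}) : 'rV[R]_n * R :=
  let l := (1 - delta) / 2 * Q.2 in
  (\row_i (Q.1 ord0 i + (e i)%:R * (Q.2 - l)), l).
exists [seq corner Q e | Q <- s, e <- enum {ffun 'I_n -> bool}].
  by rewrite size_allpairs sk -cardE card_ffun card_bool card_ord expnSr.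
move=> _ [Q /ss sQ [e _ <-]].
by apply: (allpairs_f corner) => //; rewrite mem_enum.
Qed.

Lemma cantor_content_upper_bound (d : R) k :
  0 < delta -> delta < 1 -> 0 < d -> d < n%:R ->
  2 `^ (n%:R - d) * (1 - delta) `^ d = 1 ->
  (dyadic_content d (cantor_step n delta k) <= ((2 ^ n)%:R * 2 `^ d)%:E)%E.
Proof.
move=> delta0 delta1 d0 dn hd.
have lam0 : 0 < lam by rewrite /lam; lra.
have lamk0 : 0 < lam ^+ k by rewrite exprn_gt0.
have [s sk ss] := cantor_cubes_enum k.
have -> : (2 ^ n)%:R * 2 `^ d =
    (size s)%:R * ((2 ^ n)%:R * (2 * lam ^+ k) `^ d) :> R.
  rewrite sk powRM ?(ltW lamk0)// -powR_mulrn ?(ltW lam0)// -powRrM mulrC.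
  rewrite [k%:R * d]mulrC powRrM powR_mulrn ?powR_ge0//.
  have := congr1 (fun x => x ^+ k) (ratio_dimension R n d delta delta1 hd).
  rewrite -/lam exprMn expr1n -natrX => h.
  rewrite -[LHS]mulr1 -[X in _ * X = _]h; ring.
apply: (le_trans _ (dyadic_content_seq_le _ _ _ _ s
  (fun Q => cube (Q.1, lam ^+ k)) ((2 ^ n)%:R * (2 * lam ^+ k) `^ d) _)).
  apply: le_dyadic_content => x [Q Qk xQ]; exists Q; first exact: ss.
  by rewrite -(cantor_cubes_side _ _ _ _ _ Qk) -surjective_pairing.
by move=> Q; apply: dyadic_content_cube_le => //; exact: ltW.
Qed.
End cantor_upper.

(** * A bump function with finite Choquet norms *)

(** The integral of a nonnegative function is a supremum over the simple
    functions below it, so it is monotone whether or not the functions are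
    measurable. This spares the measurability of the level functions in Choquet
    integrals and of compact sets. *)
Lemma ge0_le_integral_pointwise d (T : measurableType d) (R : realType)
    (mu : {measure set T -> \bar R}) (D : set T) (f g : T -> \bar R) :
  (forall x, D x -> 0 <= f x)%E -> (forall x, D x -> f x <= g x)%E ->
  (\int[mu]_(x in D) f x <= \int[mu]_(x in D) g x)%E.
Proof.
move=> f0 fg; rewrite !ge0_integralE//; last first.
  by move=> x Dx; rewrite (le_trans (f0 _ Dx))// fg.
apply: ereal_sup_le => _ [h hf <-]; exists h => // x; apply: (le_trans (hf x)).
by rewrite /patch; case: ifP => // /set_mem; exact: fg.
Qed.

Section bump.
Context (R : realType) (n : nat).

Definition plateau (t : R) : R := Num.max 0 (Num.min 1 (2 - `|t|)).
Definition bump (x : 'rV[R]_n) : R := \prod_i plateau (x ord0 i).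

Lemma plateau_itv t : 0 <= plateau t <= 1.
Proof. by rewrite /plateau le_max lexx ge_max ler01 ge_min lexx. Qed.

Lemma plateau1 t : `|t| <= 1 -> plateau t = 1.
Proof. by move=> t1; rewrite /plateau min_l ?max_r//; lra. Qed.

Lemma plateau0 t : 2 <= `|t| -> plateau t = 0.
Proof. by move=> t2; rewrite /plateau max_l// ge_min; apply/orP; right; lra. Qed.

Lemma plateau_continuous : continuous plateau.
Proof.
move=> t; apply: (@continuous_max R R (cst 0) (cst 1 \min (fun t => 2 - `|t|))).
  exact: cvg_cst.
apply: continuous_min; first exact: cvg_cst.
by apply: cvgB; [exact: cvg_cst|exact: norm_continuous].
Qed.

Lemma bump_ge0 x : 0 <= bump x.
Proof. by apply: prodr_ge0 => i _; have /andP[] := plateau_itv (x ord0 i). Qed.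

Lemma bump_le1 x : bump x <= 1.
Proof. by apply: prodr_ile1 => i _; exact: plateau_itv. Qed.

Lemma bump1 x : cube (0, 1) x -> bump x = 1.
Proof.
move=> /cubeP x01; apply: big1 => i _; apply: plateau1.
by have := x01 i; rewrite mxE/= add0r => /andP[? /ltW]; rewrite ger0_norm.
Qed.

Lemma bump_neq0 x : bump x != 0 -> forall i, `|x ord0 i| < 2.
Proof.
move=> fx i; rewrite ltNge; apply/negP => /plateau0 px.
by move: fx; rewrite /bump (bigD1 i)//= px mul0r eqxx.
Qed.

Lemma bump_support x : bump x != 0 -> cube (const_mx (-2), 4) x.
Proof.
move=> /bump_neq0 h; apply/cubeP => i; rewrite mxE/=.
by have := h i; rewrite ltr_norml => /andP[? ?]; lra.
Qed.

Lemma bump_continuous : continuous bump.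
Proof.
apply: continuous_big => [|i _ x]; first exact: mul_continuous.
by apply: continuous_comp; [exact: coord_continuous|exact: plateau_continuous].
Qed.

Lemma bump_C0 : C0 bump.
Proof.
split; first exact: bump_continuous.
have K : compact [set x : 'rV[R]_n | forall i, `[-2, 2]%classic (x ord0 i)].
  by apply: (@rV_compact R n (fun=> `[-2, 2]%classic)) => i; exact: segment_compact.
apply: (subclosed_compact _ K); first exact: closed_closure.
have cK := compact_closed (@norm_hausdorff _ _) K.
rewrite [X in _ `<=` X]((closure_id _).1 cK); apply: closure_subset => x.
move=> /bump_neq0 h i; rewrite /= in_itv/=; have := h i.
by rewrite ltr_norml => /andP[? ?]; lra.
Qed.

Lemma measurable_bump :
  measurable_fun [set: lebesgueType R n] (bump : lebesgueType R n -> R).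
Proof.
apply: measurable_prod => i _.
apply: measurableT_comp; last exact: measurable_coord.
by apply: continuous_measurable_fun; exact: plateau_continuous.
Qed.

Lemma bump_locally_integrable : locally_integrable_rV bump.
Proof.
split; first exact: measurable_bump.
move=> K _; pose B : set (lebesgueType R n) := cube (const_mx (-2), 4).
have mB : measurable B by exact: measurable_box.
apply: (@le_lt_trans _ _ (lebesgue_rV B)); last first.
  by rewrite /lebesgue_rV lebesgue_outer_box ltry.
rewrite -[leRHS]mul1e -integral_cst// [leLHS]integral_mkcond [leRHS]integral_mkcond.
apply: ge0_le_integral_pointwise => x _.
  by rewrite /patch; case: ifP => // _; rewrite lee_fin.
rewrite /patch; case: ifP => _; case: ifPn => [xB|xB] //.
  by rewrite lee_fin ger0_norm ?bump_ge0// bump_le1.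
rewrite lee_fin; have [->|/bump_support] := eqVneq (bump x) 0.
  by rewrite normr0.
by move=> /mem_set; rewrite (negbTE xB).
Qed.

Lemma dyadic_content_set0 (d : R) : dyadic_content d (set0 : set 'rV[R]_n) = 0.
Proof.
apply/eqP; rewrite eq_le dyadic_content_ge0 andbT.
apply: ereal_inf_lbound; exists set0; last by rewrite esum_set0.
exact: sub0set.
Qed.

Lemma bump_choquet_space (d p : R) : 0 < p -> choquet_space d p bump.
Proof.
move=> p0 e e0; exists bump; first exact: bump_C0.
rewrite /choquet_norm /choquet_integral.
rewrite integral0_eq ?poweR0r ?lte_fin ?invr_neq0 ?gt_eqF// => t.
rewrite /= in_itv/= andbT => t0; rewrite (_ : [set x | _] = set0).
  exact: dyadic_content_set0.
rewrite -subset0 => x /=; rewrite subrr normr0 powR0 ?gt_eqF//.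
by rewrite lte_fin ltNge (ltW t0).
Qed.

(** The level sets are empty from level 1 on, and below it they lie in a fixed
    cube. *)
Lemma bump_choquet_norm_lty (d p : R) : 0 <= d -> 0 < p ->
  (choquet_norm d p (EFin \o bump) < +oo)%E.
Proof.
move=> d0 p0; rewrite /choquet_norm /choquet_integral; apply: poweR_lty.
pose c : R := (2 ^ n)%:R * (2 * 4) `^ d.
apply: (@le_lt_trans _ _
    (\int[lebesgue_measure]_(t in `]0%R, +oo[) (c%:E * (\1_`]0%R, 1%R[ t)%:E))%E).
  apply: ge0_le_integral_pointwise => t; first by move=> _; exact: dyadic_content_ge0.
  rewrite /= in_itv/= andbT => t0; rewrite indicE mem_setE in_itv/= t0/=.
  have [t1|t1] := ltP t 1; last first.
    rewrite mule0 (_ : [set x | _] = set0) ?dyadic_content_set0//.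
    rewrite -subset0 => x /=; rewrite lte_fin; apply/negP.
    rewrite -leNgt (le_trans _ t1)// ger0_norm ?bump_ge0//.
    rewrite (_ : 1 = 1 `^ p); last by rewrite powR1.
    by apply: ge0_ler_powR; rewrite ?nnegrE ?bump_ge0 ?bump_le1// ltW.
  rewrite mule1; apply: le_trans (dyadic_content_cube_le _ _ _ d0 (const_mx (-2)) 4 _) => //.
  apply: le_dyadic_content => x /=; rewrite lte_fin => fx.
  apply: bump_support; apply: contraTneq fx => ->.
  by rewrite normr0 powR0 ?gt_eqF// -leNgt ltW.
rewrite ge0_integralZl_EFin//; last 2 first.
- by apply/measurable_EFinP; exact: measurable_indic.
- by rewrite mulr_ge0// powR_ge0.
rewrite integral_indic// setIidl; last first.
  by move=> t /=; rewrite !in_itv/= => /andP[->].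
rewrite -[X in (_ * X)%E]/(lebesgue_measure `]0%R, 1%R[%classic).
rewrite lebesgue_measure_itv/= lte_fin ltr01 sube0.
by rewrite mule1 ltry.
Qed.

Lemma average_bump (Q : 'rV[R]_n * R) :
  0 < Q.2 -> cube Q `<=` cube (0, 1) -> average bump Q = 1.
Proof.
move=> Q0 Q01; rewrite /average.
have mQ : measurable (cube Q : set (lebesgueType R n)) by exact: measurable_box.
have volQ : lebesgue_rV (cube Q : set (lebesgueType R n)) = (Q.2 ^+ n)%:E.
  by rewrite /lebesgue_rV lebesgue_outer_box box_volume_cube// ltW.
rewrite (@eq_Rintegral _ _ _ _ _ (cst 1)); last by move=> x /set_mem /Q01 /bump1.
rewrite Rintegral_cst//= mul1r.
by rewrite volQ/= mulVf// gt_eqF// exprn_gt0.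
Qed.

End bump.

(** * The sparse operator on the bump *)

Section cantor_sparse.
Context (R : realType) (n : nat) (delta : R).
Context (delta_gt0 : 0 < delta) (delta_lt1 : delta < 1).
Let lam : R := (1 - delta) / 2.
Let lam_gt0 : 0 < lam. Proof. by rewrite /lam; move: delta_lt1; lra. Qed.
Let lam_lt1 : lam < 1. Proof. by rewrite /lam; move: delta_gt0 delta_lt1; lra. Qed.

Lemma average_bump_cantor Q : cantor_family n delta Q -> average (@bump R n) Q = 1.
Proof.
move=> [k _ Qk]; apply: average_bump.
  by rewrite (cantor_cubes_side _ _ _ _ _ Qk) exprn_gt0.
rewrite -(cantor_step0 R n delta).
apply: subset_trans (cantor_step_nonincreasing _ _ _ delta_gt0 delta_lt1 0 k _) => //.
by move=> x xQ; exists Q.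
Qed.

(** A point of the k-th step lies in one cube of each of the stages 0 to k. These
    k + 1 cubes are distinct since their sides are, and each contributes its
    average 1. *)
Lemma sparse_operator_bump_ge k x : cantor_step n delta k x ->
  ((k.+1%:R)%:E <= sparse_operator (cantor_family n delta) (@bump R n) x)%E.
Proof.
move=> xk; rewrite /sparse_operator.
pose g (Q : 'rV[R]_n * R) : \bar R := (\1_(cube Q) x)%:E.
have g0 Q : (0 <= g Q)%E by rewrite lee_fin.
rewrite [X in (_ <= _ - X)%E]esum1; last first.
  move=> Q SQ; rewrite funenegE average_bump_cantor// mul1r.
  by rewrite max_r// leeNl oppe0 lee_fin.
rewrite sube0 (eq_esum (b := g)); last first.
  move=> Q SQ; rewrite funeposE average_bump_cantor// mul1r max_l//.
have chain j : exists Q, (j <= k)%N -> cantor_cubes n delta j Q /\ cube Q x.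
  have [jk|] := leqP j k; last by exists (0, 1).
  by have [Q Qj xQ] := cantor_step_nonincreasing _ _ _ delta_gt0 delta_lt1 _ _ jk _ xk; exists Q.
have [F FP] : {F : nat -> 'rV[R]_n * R & forall j, (j <= k)%N ->
    cantor_cubes n delta j (F j) /\ cube (F j) x}.
  apply: (@choice _ _ (fun j Q =>
    (j <= k)%N -> cantor_cubes n delta j Q /\ cube Q x)) => j.
  exact: chain.
pose K := `I_k.+1.
have Finj : set_inj K F.
  move=> i j /set_mem/FP[Fi _] /set_mem/FP[Fj _] Fij.
  have := cantor_cubes_side _ _ _ _ _ Fi.
  rewrite Fij (cantor_cubes_side _ _ _ _ _ Fj) -/lam => /esym.
  by apply: ieexprIn => //; rewrite lt_eqF.
apply: (@le_trans _ _ (\esum_(Q in F @` K) g Q)%E); last first.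
  by apply: subset_esum => _ [j jk <-]; exists j => //; exact: (FP j jk).1.
rewrite esum_image// (eq_esum (b := cst 1%E)); last first.
  by move=> j jk; rewrite /g indicE mem_set//; exact: (FP j jk).2.
apply: esum_ge; exists K; first by split => //; exact: finite_II.
rewrite (_ : K = `I_k.+1)// -fsbig_ord /= sumEFin lee_fin.
by rewrite sumr_const card_ord.
Qed.
End cantor_sparse.

(** The Choquet integrand is then at least c on the whole half-line. *)
Lemma choquet_norm_pinfty (R : realType) (n : nat) (d p c : R)
    (u : 'rV[R]_n -> \bar R) : 0 < p -> 0 < c ->
  (forall M : R, (c%:E <= dyadic_content d [set x | M%:E <= u x])%E) ->
  choquet_norm d p u = +oo%E.
Proof.
move=> p0 c0 uc.
suff : choquet_integral d (fun x => `|u x| `^ p)%E = +oo%E.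
  by move=> H; rewrite /choquet_norm H poweRyr// invr_neq0// gt_eqF.
apply/eqP; rewrite -leye_eq.
have <- : (\int[lebesgue_measure]_(t in `]0%R, +oo[) (cst c%:E : R -> \bar R) t = +oo)%E.
  rewrite integral_cst// -[X in (_ * X)%E]/(lebesgue_measure `]0%R, +oo[%classic).
  by rewrite lebesgue_measure_itv/= ltry sube0// gt0_muley.
apply: ge0_le_integral_pointwise => t; first by rewrite lee_fin ltW.
rewrite /= in_itv/= andbT => t0.
(* adding 1 to t ^ (1 / p) turns the weak inequality into a strict one *)
apply: le_trans (uc (t `^ p^-1 + 1)) _; apply: le_dyadic_content => x /= tu.
have Mpos : 0 <= t `^ p^-1 by exact: powR_ge0.
apply: (@lt_le_trans _ _ ((t `^ p^-1 + 1) `^ p)%:E).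
  rewrite lte_fin [X in X < _](_ : _ = (t `^ p^-1) `^ p).
    by apply: gt0_ltr_powR; rewrite ?nnegrE ?addr_ge0 ?powR_ge0 ?ltrDl.
  by rewrite -powRrM mulVf ?gt_eqF// powRr1// ltW.
rewrite -poweR_EFin; apply: gt0_ler_poweR.
- exact: ltW.
- by rewrite in_itv/= leey lee_fin addr_ge0.
- by rewrite in_itv/= leey abse_ge0.
by apply: le_trans tu _; exact: lee_abs.
Qed.

Theorem mainTheorem1 (R : realType) (n : nat) (d delta : R) :
  (1 <= n)%N -> 0 < d -> d < n%:R ->
  0 < delta -> delta < 1 -> 2 `^ (n%:R - d) * (1 - delta) `^ d = 1 ->
  (exists c C : R, [/\ 0 < c, c <= C &
    forall k : nat,
      (c%:E <= dyadic_content d (cantor_step n delta k) <= C%:E)%E]) /\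
  (forall p : R, 0 < p ->
    ~ exists K : R, forall f : 'rV[R]_n -> R,
        locally_integrable_rV f -> choquet_space d p f ->
        (choquet_norm d p (sparse_operator (cantor_family n delta) f) <=
         K%:E * choquet_norm d p (EFin \o f))%E).
Proof.
move=> _ d0 dn delta0 delta1 hd.
have lower := cantor_content_lower_bound R n d delta delta0 delta1 d0 dn hd.
have upper k := cantor_content_upper_bound R n delta d k delta0 delta1 d0 dn hd.
have c0 : 0 < delta `^ d by rewrite powR_gt0.
split.
  exists (delta `^ d), ((2 ^ n)%:R * 2 `^ d); split => //.
    by rewrite -lee_fin (le_trans (lower 0) (upper 0)).
  by move=> k; rewrite lower upper.
move=> p p0 [K /(_ (@bump R n) (bump_locally_integrable R n) (bump_choquet_space R n d p p0))].
rewrite (choquet_norm_pinfty _ _ _ _ _ _ p0 c0); last first.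
  move=> M; pose k := Num.truncn M.
  apply: le_trans (lower k) _; apply: le_dyadic_content => x xk /=.
  apply: le_trans (sparse_operator_bump_ge _ _ _ delta0 delta1 k x xk).
  by rewrite lee_fin ltW// truncnS_gt.
rewrite leye_eq => /eqP Koo.
have := bump_choquet_norm_lty R n d p (ltW d0) p0.
have : (0 <= choquet_norm d p (EFin \o @bump R n))%E by exact: poweR_ge0.
by move: Koo; case: (choquet_norm _ _ _) => // r.
Qed.
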